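(* Every regular system of paths is upper convex or lower convex.
   Context: A path is the graph of a continuous function $f:[0,1]\to\mathbb{R}$. A system of paths is a finite collection of at least three paths such that: the paths have distinct endpoints (the left endpoints are pairwise distinct and the right endpoints are pairwise distinct); any two paths intersect in finitely many points; no two paths are tangent, i.e. paths cross at every point where they intersect; no three paths have a common point. The size of a system is its number of paths; a subsystem is a subset of at least three of its paths. A path belongs to the upper (lower) envelope of a system if for some $t\in[0,1]$ it lies strictly above (below) every other path of the system at $t$. A system is upper (lower) convex if all of its paths belong to its upper (lower) envelope. Signature: for a system of size $3$ whose paths are labeled $i_1<i_2<i_3$ in the order of their left endpoints from bottom to top, its signature is the word on $\{x,y,z\}$ that lists its crossings from left to right, writing $x$ for a crossing of paths $i_1,i_2$, $y$ for a crossing of $i_1,i_3$, and $z$ for a crossing of $i_2,i_3$. A system is regular if it has size at least $4$ and all of its subsystems of size $3$ have the same, non-empty, signature. *)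

(* Defs.v *)
From mathcomp Require Import all_boot all_order all_algebra.
From mathcomp Require Import finmap.
From mathcomp Require Import all_classical all_reals all_analysis.

Set Implicit Arguments.
Unset Strict Implicit.
Unset Printing Implicit Defensive.

Import Order.TTheory GRing.Theory Num.Theory.
Import numFieldNormedType.Exports.

Local Open Scope classical_set_scope.
Local Open Scope ring_scope.

(* A path is represented by a function R -> R of which only the restriction to
   [0, 1] matters, and a finite collection of paths by a family indexed by a
   finType I; such a family is automatically injective when the left endpoints
   are distinct.  Subsystems correspond to sets of indices. *)

Definition is_path (R : realType) (f : R -> R) : Prop :=
  {within `[0, 1], continuous f}.

Definition intersections (R : realType) (f g : R -> R) : set R :=
  [set t : R | t \in `[0, 1] /\ f t = g t].

Definition cross_at (R : realType) (f g : R -> R) (t : R) : Prop :=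
  ((\forall s \near t^'-, f s < g s) /\ (\forall s \near t^'+, g s < f s)) \/
  ((\forall s \near t^'-, g s < f s) /\ (\forall s \near t^'+, f s < g s)).

Record path_system (R : realType) (I : finType) (f : I -> R -> R) : Prop :=
  PathSystem {
    system_size : (3 <= #|I|)%N;
    system_path : forall i, is_path (f i);
    system_left : injective (fun i => f i 0);
    system_right : injective (fun i => f i 1);
    system_finite : forall i j, i != j ->
      finite_set (intersections (f i) (f j));
    (* Endpoints being distinct, t lies in the open interval ]0, 1[ here, so
       that both one-sided neighborhoods of t are eventually in [0, 1]. *)
    system_cross : forall i j t, i != j ->
      intersections (f i) (f j) t -> cross_at (f i) (f j) t;
    system_no_triple : forall i j k (t : R), uniq [:: i; j; k] ->
      t \in `[0, 1] -> ~ (f i t = f j t /\ f j t = f k t)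
  }.

Definition in_upper_envelope (R : realType) (I : finType) (f : I -> R -> R)
    (i : I) : Prop :=
  exists2 t : R, t \in `[0, 1] & forall j, j != i -> f j t < f i t.

Definition in_lower_envelope (R : realType) (I : finType) (f : I -> R -> R)
    (i : I) : Prop :=
  exists2 t : R, t \in `[0, 1] & forall j, j != i -> f i t < f j t.

Definition upper_convex (R : realType) (I : finType) (f : I -> R -> R) : Prop :=
  forall i, in_upper_envelope f i.

Definition lower_convex (R : realType) (I : finType) (f : I -> R -> R) : Prop :=
  forall i, in_lower_envelope f i.

Inductive letter := letter_x | letter_y | letter_z.

(* The crossings of three paths occur at distinct abscissas, since two of them
   at the same abscissa would yield a common point of the three paths; hence a
   crossing is determined by its abscissa. *)
Definition crossing_letter (R : realType) (f1 f2 f3 : R -> R) (t : R) :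
    letter :=
  if f1 t == f2 t then letter_x
  else if f1 t == f3 t then letter_y else letter_z.

Definition crossing_times (R : realType) (f1 f2 f3 : R -> R) : seq R :=
  sort <=%R (fset_set (intersections f1 f2 `|` intersections f1 f3
                       `|` intersections f2 f3)).

Definition crossing_word (R : realType) (f1 f2 f3 : R -> R) : seq letter :=
  map (crossing_letter f1 f2 f3) (crossing_times f1 f2 f3).

(* The value is meaningful only when #|B| = 3. *)
Definition signature (R : realType) (I : finType) (f : I -> R -> R)
    (B : {set I}) : seq letter :=
  if sort (fun i j => f i 0 <= f j 0) (enum B) is [:: i1; i2; i3]
  then crossing_word (f i1) (f i2) (f i3) else [::].

Definition regular (R : realType) (I : finType) (f : I -> R -> R) : Prop :=
  (4 <= #|I|)%N /\
  exists2 w : seq letter, w <> [::] &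
    forall B : {set I}, #|B| = 3%N -> signature f B = w.

(* Main.v *)
(** Two paths with distinct left endpoints are in their initial order at a time
    [t] iff they have crossed an even number of times before [t].  Hence, for a
    triple with paths 1, 2, 3 from bottom to top on the left, the signature
    determines three bits: whether 1 is below 3 when 1 and 2 first cross ([bx]),
    whether 1 is below 2 when 1 and 3 first cross ([by_]), and whether 1 is
    below 2 when 2 and 3 first cross ([bz]).  In a regular system any two paths
    cross, since a given pair plays different roles in different triples, and
    these bits are common to all triples; [bx] and [bz] are not both false, as
    each of the first crossings of 12 and of 23 would precede the other.  Let q
    be a path, p its predecessor in the left order, m the minimum and n the
    maximum.  Reading the bits in all triples containing the crossing pair gives:
    - [~~ bx && bz]: p is on top right after the first crossing of p and q;
    - [bx && ~~ bz]: q is at the bottom right after the first crossing of p and q;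
    - [bx && bz && ~~ by_]: every path other than n is on top right after its
      first crossing with n;
    - [bx && bz && by_]: every path other than m is at the bottom right after
      its first crossing with m.
    Finally n is on top, and m at the bottom, at time 0. *)

Require Import Defs.
From mathcomp Require Import all_boot all_order all_algebra.
From mathcomp Require Import finmap.
From mathcomp Require Import all_classical all_reals all_analysis.

Set Implicit Arguments.
Unset Strict Implicit.
Unset Printing Implicit Defensive.

Import Order.TTheory GRing.Theory Num.Theory.
Import numFieldNormedType.Exports.

Local Open Scope classical_set_scope.
Local Open Scope ring_scope.

(** * Order of two continuous paths on an interval *)

Lemma itv01_sub (R : realType) (a b : R) :
  a \in `[0, 1] -> b \in `[0, 1] -> `[a, b] `<=` `[0, 1].
Proof.
rewrite !in_itv /= => /andP[a0 _] /andP[_ b1] x /=.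
by rewrite !in_itv /= => /andP[ax xb]; rewrite (le_trans a0) //= (le_trans xb).
Qed.

Lemma path_order_change (R : realType) (f g : R -> R) (a b : R) :
    is_path f -> is_path g -> a \in `[0, 1] -> b \in `[0, 1] -> a <= b ->
    f a < g a -> g b < f b ->
  exists2 c, intersections f g c & a < c < b.
Proof.
move=> pf pg a01 b01 ab fga gfb.
have sub := itv01_sub a01 b01.
have cont : {within `[a, b], continuous (f - g)}.
  by apply: continuous_subspaceW (within_continuousB pf pg).
have [|c cab /eqP fgc] := IVT (v := 0) ab cont.
  by rewrite ge_min le_max !fctE !subr_le0 !subr_ge0 (ltW fga) (ltW gfb) orbT.
have {}fgc : f c = g c by move: fgc; rewrite !fctE subr_eq0 => /eqP.
exists c; first by split=> //; apply: sub.
move: cab; rewrite in_itv /= => /andP[ac cb].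
rewrite !lt_neqAle ac cb !andbT; apply/andP; split.
  by apply: contraTneq fga => ->; rewrite fgc ltxx.
by apply: contraTneq gfb => <-; rewrite fgc ltxx.
Qed.

Lemma path_order_const (R : realType) (f g : R -> R) (a b : R) :
    is_path f -> is_path g -> a \in `[0, 1] -> b \in `[0, 1] -> a <= b ->
    (forall c, intersections f g c -> a <= c <= b -> False) ->
  (f a < g a) = (f b < g b).
Proof.
move=> pf pg a01 b01 ab nc.
have nca : f a != g a.
  by apply/eqP => e; apply: (nc a) => //; rewrite lexx.
have ncb : f b != g b.
  by apply/eqP => e; apply: (nc b) => //; rewrite lexx andbT.
apply/idP/idP => h.
  have [//|h'|h'] := ltgtP (f b) (g b); last by rewrite h' eqxx in ncb.
  have [c /nc cc /andP[/ltW ac /ltW cb]] := path_order_change pf pg a01 b01 ab h h'.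
  by case: cc; rewrite ac.
have [//|h'|h'] := ltgtP (f a) (g a); last by rewrite h' eqxx in nca.
have [c [c01 cc] /andP[/ltW ac /ltW cb]] := path_order_change pg pf a01 b01 ab h' h.
by case: (nc c); [split | rewrite ac].
Qed.

Lemma path_lt_near_right (R : realType) (f g : R -> R) (t : R) :
    is_path f -> is_path g -> 0 < t < 1 -> f t < g t ->
  \forall s \near t^'+, f s < g s.
Proof.
move=> pf pg t01 fgt.
have /(continuous_within_itvP _ ltr01)[cont _ _] := within_continuousB pg pf.
have ct : {for t, continuous (g - f)} by apply: cont; rewrite in_itv.
apply: cvg_within.
near=> s; rewrite -subr_gt0; near: s.
by apply: (cvgr_gt _ ct); rewrite !fctE subr_gt0.
Unshelve. all: by end_near. Qed.

(** * Parity of the number of crossings *)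

(** Induction on the last crossing [c] before [t]: the order is constant between [c] and [t], it
    flips at [c], and just left of [c] the induction hypothesis applies. Keeping [t] general, with
    [r] listing exactly the crossings before it, allows [t] to move to the left of [c]. *)
Lemma crossing_parity_sorted (R : realType) (f g : R -> R) (r : seq R) (t : R) :
    is_path f -> is_path g -> f 0 < g 0 ->
    (forall c, intersections f g c -> cross_at f g c) ->
    sorted <%R r -> t \in `[0, 1] -> f t != g t ->
    (forall c, reflect (intersections f g c /\ c < t) (c \in r)) ->
  (f t < g t) = ~~ odd (size r).
Proof.
move=> pf pg fg0 cross; have i0 : (0 : R) \in `[0, 1].
  by rewrite in_itv /= lexx ler01.
elim/last_ind: r t => [|r c IH] t sr ti fgt rP.
  rewrite /= -(@path_order_const _ f g 0 t) //.
    by move: ti; rewrite in_itv => /andP[].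
  move=> c Sc /andP[_]; rewrite le_eqVlt => /orP[/eqP e|ct].
    by case: Sc fgt => _; rewrite e => ->; rewrite eqxx.
  by have := rP c; rewrite in_nil => /elimF; apply.
have /rP[Sc ct] : c \in rcons r c by rewrite mem_rcons inE eqxx.
have [c01 fgc] := Sc.
have c0 : 0 < c.
  move: (c01); rewrite in_itv /= lt_neqAle => /andP[-> _]; rewrite andbT.
  by apply: contraTneq fg0 => ->; rewrite fgc ltxx.
have [c1 t1] : c <= 1 /\ t <= 1.
  by move: c01 ti; rewrite !in_itv /= => /andP[_ ->] /andP[_ ->].
have rc : all (< c) r.
  apply/allP => x xr; move: sr; rewrite -cats1 lt_sorted_pairwise pairwise_cat.
  by case/and3P => /allrelP + _ _; apply; rewrite ?inE.
have sr' : sorted <%R r.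
  by apply: subseq_sorted sr => //; [exact: lt_trans | rewrite -cats1 prefix_subseq].
(* Close enough to [c], the point [s] lies beyond all of [r], so [r] is exactly the list of
   crossings before [s]. *)
have nearc : \forall s \near c^'-, [/\ 0 < s, s < c & all (< s) r].
  have hr : \forall s \near c^'-, all (< s) r.
    elim: r rc {IH sr rP sr'} => [_|x r IHr /= /andP[xc /IHr h]].
      by near=> s.
    near=> s; apply/andP; split; near: s => //.
    exact: nbhs_left_gt.
  by near=> s; split; near: s; [exact: nbhs_left_gt|exact: nbhs_left_lt|].
have key (s : R) : [/\ 0 < s, s < c & all (< s) r] ->
    f s != g s -> (f s < g s) = ~~ odd (size r).
  move=> [s0 sc rs] fgs; apply: IH => //.
    by rewrite in_itv /= (ltW s0) (le_trans (ltW sc)).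
  move=> x; apply: (iffP idP) => [xr|[Sx xs]].
    by split; [have /rP[] : x \in rcons r c by rewrite mem_rcons inE xr orbT
              |apply: (allP rs)].
  have /rP : intersections f g x /\ x < t.
    by split=> //; apply: (lt_trans xs); apply: (lt_trans sc).
  rewrite mem_rcons inE => /orP[/eqP e|//].
  by move: xs; rewrite e ltNge (ltW sc).
have keyr (s : R) : c < s -> s < t -> (f s < g s) = (f t < g t).
  move=> cs st; apply: path_order_const => //; last 1 first.
  - move=> x Sx /andP[sx]; rewrite le_eqVlt => /orP[/eqP e|xt].
      by case: Sx fgt => _; rewrite e => ->; rewrite eqxx.
    have /rP : intersections f g x /\ x < t by [].
    rewrite mem_rcons inE => /orP[/eqP e|xr].
      by move: sx; rewrite e leNgt cs.
    by move/(allP rc): xr => /= xc; move: sx; rewrite leNgt (lt_trans xc).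
  - by rewrite in_itv /= (ltW (lt_trans c0 cs)) (le_trans (ltW st)).
  - exact: ltW.
have nearr : \forall s \near c^'+, c < s /\ s < t.
  by near=> s; split; near: s; [exact: nbhs_right_gt|exact: nbhs_right_lt].
rewrite size_rcons /=.
(* In either direction of crossing, compare a sample [s] just before [c] with a sample [u] just
   after it. *)
case: (cross c Sc) => -[hl hr].
- have [s [/key ks fgs]] := filter_ex (filterI nearc hl).
  have [u [[cu ut] fgu]] := filter_ex (filterI nearr hr).
  rewrite -(keyr u) // -ks ?lt_eqF // fgs; apply/negbTE.
  by rewrite -leNgt ltW.
- have [s [/key ks fgs]] := filter_ex (filterI nearc hl).
  have [u [[cu ut] fgu]] := filter_ex (filterI nearr hr).
  by rewrite -(keyr u) // -ks ?gt_eqF // fgu -leNgt ltW.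
Unshelve. all: by end_near. Qed.

Lemma crossing_parity (R : realType) (f g : R -> R) (r : seq R) (t : R) :
    is_path f -> is_path g -> f 0 < g 0 ->
    (forall c, intersections f g c -> cross_at f g c) ->
    sorted <%R r -> (forall c, reflect (intersections f g c) (c \in r)) ->
    t \in `[0, 1] -> f t != g t ->
  (f t < g t) = ~~ odd (count (< t) r).
Proof.
move=> pf pg fg0 cross sr rP ti fgt; rewrite -size_filter.
apply: crossing_parity_sorted => //.
  by apply: sorted_filter => //; apply: lt_trans.
by move=> c; rewrite mem_filter andbC; apply: (iffP andP) => -[/rP].
Qed.

(** * Reading the order of paths from the crossing word *)

Definition is_x (l : letter) : bool := if l is letter_x then true else false.
Definition is_y (l : letter) : bool := if l is letter_y then true else false.
Definition is_z (l : letter) : bool := if l is letter_z then true else false.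

(** The combinatorial form of the three bits: by parity, it tells whether the two paths crossing at
    the [Q]-letters are in their initial order at the first [P]-letter. *)
Definition even_before (P Q : pred letter) (w : seq letter) : bool :=
  ~~ odd (count Q (take (find P w) w)).

Definition first_crossing (R : realType) (f g : R -> R) (t : R) : Prop :=
  intersections f g t /\ forall c, intersections f g c -> t <= c.

(** Bridges positions and times: in a strictly increasing list, the entries placed before the first
    one satisfying [P] are those smaller than it. *)
Lemma count_before_first (R : realType) (P Q : pred R) (s : seq R) (t : R) :
    sorted <%R s -> t \in s -> P t -> {in s, forall c, P c -> t <= c} ->
  count Q (take (find P s) s) = count (< t) [seq c <- s | Q c].
Proof.
elim: s => // x s IH /= sxs; have /allP xs := order_path_min lt_trans sxs.
rewrite inE => ts Pt tmin.
case: ifP => Px /=.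
  have tx : t <= x by apply: tmin; rewrite ?inE ?eqxx.
  apply/esym/eqP; rewrite -leqn0 leqNgt -has_count -all_predC.
  apply/allP => c; have ->: (if Q x then x :: [seq c <- s | Q c] else [seq c <- s | Q c]) =
    [seq c <- x :: s | Q c] by [].
  rewrite mem_filter inE /= -leNgt => /andP[_ /orP[/eqP-> //|/xs xc]].
  exact: le_trans (ltW xc).
have {}ts : t \in s.
  by case/orP: ts => // /eqP e; rewrite -e Pt in Px.
rewrite IH //; last 2 first.
- exact: path_sorted sxs.
- by move=> c cs; apply: tmin; rewrite inE cs orbT.
by case: (Q x) => //=; rewrite (xs t ts).
Qed.

Lemma ex_first_crossing (R : realType) (f g : R -> R) :
    finite_set (intersections f g) -> (exists t, intersections f g t) ->
  exists t, first_crossing f g t.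
Proof.
move=> fin [t Ht].
have mem c : (c \in fset_set (intersections f g)) = (c \in intersections f g).
  by rewrite in_fset_set.
have := sort_sorted (@le_total _ R) (fset_set (intersections f g)).
have := mem_sort <=%R (fset_set (intersections f g)).
case: (sort _ _) => [/(_ t)|m s memE sm]; first by rewrite in_nil mem mem_set.
have mms : m \in m :: s by rewrite inE eqxx.
exists m; split; first by move: mms; rewrite memE mem => /set_mem.
move=> c /mem_set; rewrite -mem -memE inE => /orP[/eqP->//|].
exact/allP/(order_path_min le_trans).
Qed.

Record path_triple (R : realType) (f1 f2 f3 : R -> R) : Prop := PathTriple {
  triple_path1 : is_path f1;
  triple_path2 : is_path f2;
  triple_path3 : is_path f3;
  triple_lt12 : f1 0 < f2 0;
  triple_lt23 : f2 0 < f3 0;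
  triple_finite12 : finite_set (intersections f1 f2);
  triple_finite13 : finite_set (intersections f1 f3);
  triple_finite23 : finite_set (intersections f2 f3);
  triple_cross12 : forall t, intersections f1 f2 t -> cross_at f1 f2 t;
  triple_cross13 : forall t, intersections f1 f3 t -> cross_at f1 f3 t;
  triple_no_common : forall t, t \in `[0, 1] -> ~ (f1 t = f2 t /\ f2 t = f3 t) }.

Lemma mem_crossing_times (R : realType) (f1 f2 f3 : R -> R) (t : R) :
    path_triple f1 f2 f3 ->
  t \in crossing_times f1 f2 f3 =
    (t \in `[0, 1]) && [|| f1 t == f2 t, f1 t == f3 t | f2 t == f3 t].
Proof.
case=> _ _ _ _ _ fin12 fin13 fin23 _ _ _.
rewrite mem_sort in_fset_set ?finite_setU //.
apply/idP/idP => [/set_mem|].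
  by move=> [[]|] [-> ->]; rewrite eqxx ?orbT.
case/andP=> t01 h; apply/mem_set.
by case/or3P: h => /eqP e; [left; left|left; right|right].
Qed.

Lemma crossing_times_sorted (R : realType) (f1 f2 f3 : R -> R) :
  sorted <%R (crossing_times f1 f2 f3).
Proof. by rewrite sort_lt_sorted fset_uniq. Qed.

(** The nested tests with default [letter_z] become three independent equalities, because two of
    them at once would give a common point of the three paths. *)
Lemma crossing_letterE (R : realType) (f1 f2 f3 : R -> R) :
    path_triple f1 f2 f3 -> {in crossing_times f1 f2 f3, forall t,
  [/\ is_x (crossing_letter f1 f2 f3 t) = (f1 t == f2 t),
      is_y (crossing_letter f1 f2 f3 t) = (f1 t == f3 t) &
      is_z (crossing_letter f1 f2 f3 t) = (f2 t == f3 t)]}.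
Proof.
move=> tr t; rewrite mem_crossing_times // => /andP[t01].
have := triple_no_common tr t01; rewrite /crossing_letter.
case: eqVneq => [->|e12].
  by case: (eqVneq (f2 t)) => [->|//] nc; case: nc.
case: (eqVneq (f1 t) (f3 t)) => [e13 _ _|_ _ /= ->] //=; split=> //.
by rewrite -e13 eq_sym (negbTE e12).
Qed.

Lemma has_crossing_word (R : realType) (f1 f2 f3 u v : R -> R)
    (P : pred letter) :
    path_triple f1 f2 f3 ->
    (forall t, intersections u v t -> t \in crossing_times f1 f2 f3) ->
    {in crossing_times f1 f2 f3,
      forall t, P (crossing_letter f1 f2 f3 t) = (u t == v t)} ->
  reflect (exists t, intersections u v t) (has P (crossing_word f1 f2 f3)).
Proof.
move=> tr sub PE; rewrite has_map; apply: (iffP hasP) => [[t ts /=]|[t Ht]].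
  rewrite PE // => /eqP e; exists t; split=> //.
  by move: ts; rewrite mem_crossing_times // => /andP[].
by exists t; rewrite ?sub //= PE ?sub //; case: Ht => _ ->.
Qed.

(** Crossing parity for [p], [q] at [t], transported to the word through [count_before_first]. The
    pairs [u], [v] and [p], [q] are left free so that one proof yields all three bits. *)
Lemma even_before_crossing_word (R : realType) (f1 f2 f3 u v p q : R -> R)
    (P Q : pred letter) (t : R) :
    path_triple f1 f2 f3 ->
    (forall t, intersections u v t -> t \in crossing_times f1 f2 f3) ->
    (forall t, intersections p q t -> t \in crossing_times f1 f2 f3) ->
    {in crossing_times f1 f2 f3,
      forall t, P (crossing_letter f1 f2 f3 t) = (u t == v t)} ->
    {in crossing_times f1 f2 f3,
      forall t, Q (crossing_letter f1 f2 f3 t) = (p t == q t)} ->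
    is_path p -> is_path q -> p 0 < q 0 ->
    (forall t, intersections p q t -> cross_at p q t) ->
    first_crossing u v t -> p t != q t ->
  (p t < q t) = even_before P Q (crossing_word f1 f2 f3).
Proof.
move=> tr suv spq PE QE pp pq pq0 cr [uvt tmin] npq.
have sorteds := crossing_times_sorted f1 f2 f3.
rewrite /even_before /crossing_word find_map -map_take count_map.
rewrite (count_before_first _ sorteds (t := t)) ?suv //=.
- apply: crossing_parity => //; last by case: uvt.
    by apply: sorted_filter => //; apply: lt_trans.
  move=> c; rewrite mem_filter /=; apply: (iffP andP) => [[+ cs]|pqc].
    rewrite QE // => /eqP e; split=> //.
    by move: cs; rewrite mem_crossing_times // => /andP[].
  by rewrite QE ?spq //; case: pqc => _ ->; rewrite eqxx.
- by rewrite PE ?suv //; case: uvt => _ ->.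
- move=> c cs /=; rewrite PE // => /eqP e; apply: tmin; split=> //.
  by move: cs; rewrite mem_crossing_times // => /andP[].
Qed.

Lemma path_tripleP (R : realType) (f1 f2 f3 : R -> R) :
    path_triple f1 f2 f3 ->
  let w := crossing_word f1 f2 f3 in
  [/\ has is_x w <-> exists t, intersections f1 f2 t,
      has is_y w <-> exists t, intersections f1 f3 t &
      has is_z w <-> exists t, intersections f2 f3 t] /\
  [/\ forall t, first_crossing f1 f2 t -> (f1 t < f3 t) = even_before is_x is_y w,
      forall t, first_crossing f1 f3 t -> (f1 t < f2 t) = even_before is_y is_x w &
      forall t, first_crossing f2 f3 t -> (f1 t < f2 t) = even_before is_z is_x w].
Proof.
move=> tr w.
have EL := crossing_letterE tr.
have Ex : {in crossing_times f1 f2 f3,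
  forall t, is_x (crossing_letter f1 f2 f3 t) = (f1 t == f2 t)}.
  by move=> t /EL[].
have Ey : {in crossing_times f1 f2 f3,
  forall t, is_y (crossing_letter f1 f2 f3 t) = (f1 t == f3 t)}.
  by move=> t /EL[].
have Ez : {in crossing_times f1 f2 f3,
  forall t, is_z (crossing_letter f1 f2 f3 t) = (f2 t == f3 t)}.
  by move=> t /EL[].
have S12 t : intersections f1 f2 t -> t \in crossing_times f1 f2 f3.
  by move=> [t01 e]; rewrite mem_crossing_times // t01 e eqxx.
have S13 t : intersections f1 f3 t -> t \in crossing_times f1 f2 f3.
  by move=> [t01 e]; rewrite mem_crossing_times // t01 e eqxx orbT.
have S23 t : intersections f2 f3 t -> t \in crossing_times f1 f2 f3.
  by move=> [t01 e]; rewrite mem_crossing_times // t01 e eqxx !orbT.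
have nc t : t \in `[0, 1] -> ~ (f1 t = f2 t /\ f2 t = f3 t).
  exact: triple_no_common.
split.
  by split; apply: iff_sym; apply: rwP; apply: has_crossing_word.
case: (tr) => p1 p2 p3 l12 l23 _ _ _ c12 c13 _.
split=> t Ht; case: (Ht) => -[t01 e] _.
- apply: (even_before_crossing_word tr S12 S13) => //; first exact: lt_trans l23.
  by apply/eqP => e13; apply: (nc t) => //; rewrite -e13 -e.
- apply: (even_before_crossing_word tr S13 S12) => //.
  by apply/eqP => e12; apply: (nc t) => //; rewrite -e12 -e.
- apply: (even_before_crossing_word tr S23 S12) => //.
  by apply/eqP => e12; apply: (nc t).
Qed.

(** * The situation right after a first crossing *)

(** The crossing swaps [p] and [q], and strict inequalities with the other paths at [t] persist by
    continuity. *)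
Lemma near_after_first_crossing (R : realType) (I : finType) (f : I -> R -> R)
    (p q : I) (t : R) :
    path_system f -> f p 0 < f q 0 -> first_crossing (f p) (f q) t ->
  \forall s \near t^'+, [/\ s \in `[0, 1], f q s < f p s &
    forall r, r != p -> r != q ->
      (f r t < f p t -> f r s < f p s) /\ (f q t < f r t -> f q s < f r s)].
Proof.
move=> sys pq0 [[t01 e] tmin].
have pq : p != q by apply: contraTneq pq0 => ->; rewrite ltxx.
have pf := system_path sys.
have i0 : (0 : R) \in `[0, 1] by rewrite in_itv /= lexx ler01.
(* Distinct left and right endpoints exclude a crossing at [0] or [1]. *)
have {t01} t01 : 0 < t < 1.
  move: t01; rewrite in_itv /= !lt_neqAle => /andP[-> ->]; rewrite !andbT.
  apply/andP; split.
    by apply: contraTneq pq0 => ->; rewrite e ltxx.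
  apply: contraNneq pq => t1; apply/eqP; apply: (system_right sys).
  by rewrite -t1.
have [t0 t1] := andP t01.
have t01' : t \in `[0, 1] by rewrite in_itv /= !ltW.
have swap : \forall s \near t^'+, f q s < f p s.
  (* In the opposite direction [q] would be below [p] before [t], which forces a crossing earlier
     than the first one. *)
  case: (system_cross sys pq (conj t01' e)) => -[hl hr] //.
  have pos : \forall s \near t^'-, 0 < s /\ s < t.
    by near=> s; split; near: s; [exact: nbhs_left_gt|exact: nbhs_left_lt].
  have [s [[s0 st] qps]] := filter_ex (filterI pos hl).
  have s01 : s \in `[0, 1] by rewrite in_itv /= (ltW s0) ltW // (lt_trans st).
  have [c /tmin tc /andP[_ cs]] :=
    path_order_change (pf p) (pf q) i0 s01 (ltW s0) pq0 qps.
  by have := lt_trans (le_lt_trans tc cs) st; rewrite ltxx.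
have below : \forall s \near t^'+, forall r, f r t < f p t -> f r s < f p s.
  (* Finiteness of [I] provides one neighborhood that serves all [r]. *)
  apply: filter_forall => r; have [h|h] := boolP (f r t < f p t).
    by apply: filterS (path_lt_near_right (pf r) (pf p) t01 h).
  by apply: nearW.
have above : \forall s \near t^'+, forall r, f q t < f r t -> f q s < f r s.
  apply: filter_forall => r; have [h|h] := boolP (f q t < f r t).
    by apply: filterS (path_lt_near_right (pf q) (pf r) t01 h).
  by apply: nearW.
near=> s; split.
- rewrite in_itv /= (@ltW _ _ 0) /=; last first.
    by apply: lt_trans t0 _; near: s; exact: nbhs_right_gt.
  by near: s; exact: nbhs_right_le.
- by near: s.
- by move=> r _ _; split; move: r; near: s.
Unshelve. all: by end_near. Qed.

Lemma upper_after_first_crossing (R : realType) (I : finType)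
    (f : I -> R -> R) (p q : I) (t : R) :
    path_system f -> f p 0 < f q 0 -> first_crossing (f p) (f q) t ->
    (forall r, r != p -> r != q -> f r t < f p t) ->
  in_upper_envelope f p.
Proof.
move=> sys pq0 ft below.
have [s [s01 qp h]] := filter_ex (near_after_first_crossing sys pq0 ft).
exists s => // r rp; have [->//|rq] := eqVneq r q.
by apply: (h r rp rq).1; apply: below.
Qed.

Lemma lower_after_first_crossing (R : realType) (I : finType)
    (f : I -> R -> R) (p q : I) (t : R) :
    path_system f -> f p 0 < f q 0 -> first_crossing (f p) (f q) t ->
    (forall r, r != p -> r != q -> f p t < f r t) ->
  in_lower_envelope f q.
Proof.
move=> sys pq0 ft above; have [[_ e] _] := ft.
have [s [s01 qp h]] := filter_ex (near_after_first_crossing sys pq0 ft).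
exists s => // r rq; have [->//|rp] := eqVneq r p.
by apply: (h r rp rq).2; rewrite -e; apply: above.
Qed.

(** * Triples in a system and consequences of regularity *)

Lemma path_system_triple (R : realType) (I : finType) (f : I -> R -> R)
    (i j k : I) :
  path_system f -> f i 0 < f j 0 -> f j 0 < f k 0 ->
  path_triple (f i) (f j) (f k).
Proof.
move=> sys ij jk.
have ne a b : f a 0 < f b 0 -> a != b.
  by move=> ab; apply: contraTneq ab => ->; rewrite ltxx.
have [[nij njk] nik] := (ne _ _ ij, ne _ _ jk, ne _ _ (lt_trans ij jk)).
have := system_path sys; have := system_finite sys; have := system_cross sys.
move=> cr fin pf; apply: PathTriple => //; try exact: fin; try by move=> t; apply: cr.
by move=> t; apply: (system_no_triple sys); rewrite /= !inE negb_or nij nik njk.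
Qed.

Lemma signature_crossing_word (R : realType) (I : finType) (f : I -> R -> R)
    (i j k : I) :
    path_system f -> f i 0 < f j 0 -> f j 0 < f k 0 ->
  #|[set i; j; k]%SET| = 3%N /\
  signature f [set i; j; k]%SET = crossing_word (f i) (f j) (f k).
Proof.
move=> sys ij jk.
have ne a b : f a 0 < f b 0 -> a != b.
  by move=> ab; apply: contraTneq ab => ->; rewrite ltxx.
have [[nij njk] nik] := (ne _ _ ij, ne _ _ jk, ne _ _ (lt_trans ij jk)).
have uijk : uniq [:: i; j; k] by rewrite /= !inE negb_or nij nik njk.
have pe : perm_eq (enum [set i; j; k]%SET) [:: i; j; k].
  apply: uniq_perm => //; first exact: enum_uniq.
  by move=> x; rewrite mem_enum !inE -orbA.
split; first by rewrite cardE (perm_size pe).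
(* Distinct left endpoints make this a total order on indices, so the sorted list does not depend on
   how the set is enumerated. *)
pose le_left i j := f i 0 <= f j 0.
have tot : total le_left by move=> a b; apply: le_total.
have tr : transitive le_left by move=> a b c; apply: le_trans.
have anti : antisymmetric le_left.
  by move=> a b /le_anti /(system_left sys).
rewrite /signature (_ : sort _ _ = [:: i; j; k]) //.
rewrite (perm_sortP tot tr anti _ _ pe).
by apply: (sorted_sort tr); rewrite /= /le_left !ltW.
Qed.

Lemma ex_left_sorted4 (R : realType) (I : finType) (f : I -> R -> R) :
    path_system f -> (4 <= #|I|)%N ->
  exists a b c d, [/\ f a 0 < f b 0, f b 0 < f c 0 & f c 0 < f d 0].
Proof.
move=> sys; rewrite cardE.
pose lt_left i j := f i 0 <= f j 0.
have tot : total lt_left by move=> i j; apply: le_total.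
have := sort_sorted tot (enum I).
have : uniq (sort lt_left (enum I)) by rewrite sort_uniq enum_uniq.
rewrite -(size_sort lt_left).
case: (sort _ _) => [|a [|b [|c [|d s]]]] // + + _.
have lt i j : i != j -> f i 0 <= f j 0 -> f i 0 < f j 0.
  move=> ij; rewrite lt_neqAle => ->; rewrite andbT.
  by apply: contraNneq ij => /(system_left sys) ->.
rewrite /= !inE !negb_or => /and5P[/and4P[ab _ _ _] /and3P[bc _ _] /andP[cd _] _ _].
by move=> /and4P[*]; exists a, b, c, d; split; apply: lt.
Qed.

Lemma regular_path_system (R : realType) (I : finType) (f : I -> R -> R) :
    path_system f -> regular f ->
  exists bx by_ bz : bool,
  (forall p q, f p 0 < f q 0 -> exists t, first_crossing (f p) (f q) t) /\
  forall i j k, f i 0 < f j 0 -> f j 0 < f k 0 ->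
  [/\ forall t, first_crossing (f i) (f j) t -> (f i t < f k t) = bx,
      forall t, first_crossing (f i) (f k) t -> (f i t < f j t) = by_ &
      forall t, first_crossing (f j) (f k) t -> (f i t < f j t) = bz].
Proof.
move=> sys [I4 [w w0 ws]].
exists (even_before is_x is_y w), (even_before is_y is_x w),
  (even_before is_z is_x w).
have tripleP i j k : f i 0 < f j 0 -> f j 0 < f k 0 ->
    path_triple (f i) (f j) (f k) /\ crossing_word (f i) (f j) (f k) = w.
  move=> ij jk; have [c3 <-] := signature_crossing_word sys ij jk.
  by split; [exact: path_system_triple | exact: ws].
split; last first.
  by move=> i j k ij /(tripleP _ _ _ ij)[/path_tripleP[_ +] e]; rewrite e.
have hasP i j k : f i 0 < f j 0 -> f j 0 < f k 0 ->
  [/\ has is_x w <-> exists t, intersections (f i) (f j) t,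
      has is_y w <-> exists t, intersections (f i) (f k) t &
      has is_z w <-> exists t, intersections (f j) (f k) t].
  by move=> ij /(tripleP _ _ _ ij)[/path_tripleP[+ _] e]; rewrite e.
have [a [b [c [d [ab bc cd]]]]] := ex_left_sorted4 sys I4.
have [x1 y1 z1] := hasP a b c ab bc.
have [x2 y2 z2] := hasP a c d (lt_trans ab bc) cd.
have [x3 y3 z3] := hasP b c d bc cd.
(* The pair [a], [c] reads as [y] in [abc] and as [x] in [acd]; the pair [b], [c] reads as [z] in
   [abc] and as [x] in [bcd]. So any first letter of [w] forces [x] to occur, and [x] forces [y] and
   [z]. *)
have [hx hy hz] : [/\ has is_x w, has is_y w & has is_z w].
  have yx : has is_y w -> has is_x w by move/y1/x2.
  have zx : has is_z w -> has is_x w by move/z1/x3.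
  have hx : has is_x w.
    case: w w0 {ws tripleP hasP x1 y1 z1 x2 y2 z2 x3 y3 z3} yx zx => [|[] w] //= _.
      by move=> + _; apply.
    by move=> _; apply.
  by split=> //; [apply/y1/x2 | apply/z1/x3].
move=> p q pq; apply: ex_first_crossing.
  apply: (system_finite sys).
  by apply: contraTneq pq => ->; rewrite ltxx.
(* Any third path [r] will do: its position relative to [p] and [q] decides which letter stands for
   their crossings, and all three letters occur. *)
have /card_gt0P[r] : (0 < #|~: [set p; q]%SET|)%N.
  rewrite -(ltn_add2l #|[set p; q]%SET|) cardsC addn0 (leq_trans _ I4) //.
  by rewrite ltnS cards2; case: (_ == _).
rewrite !inE negb_or => /andP[rp rq].
have [rp0|pr0|/(system_left sys) e] := ltgtP (f r 0) (f p 0).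
- by have [_ _ z] := hasP r p q rp0 pq; apply/z.
- have [rq0|qr0|/(system_left sys) e] := ltgtP (f r 0) (f q 0).
  + by have [_ y _] := hasP p r q pr0 rq0; apply/y.
  + by have [x _ _] := hasP p q r pq qr0; apply/x.
  + by rewrite e eqxx in rq.
- by rewrite e eqxx in rp.
Qed.

(** * Case analysis on the three bits *)

Theorem theorem2p15 (R : realType) (I : finType) (f : I -> R -> R) :
  path_system f -> regular f -> upper_convex f \/ lower_convex f.
Proof.
move=> sys reg.
have [bx [by_ [bz [cross orders]]]] := regular_path_system sys reg.
have i0 : (0 : R) \in `[0, 1] by rewrite in_itv /= lexx ler01.
have left_lt i j : i != j -> f i 0 <= f j 0 -> f i 0 < f j 0.
  move=> ij; rewrite lt_neqAle => ->; rewrite andbT.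
  by apply: contraNneq ij => /(system_left sys) ->.
(* No third path passes through a crossing, so at [t] a negated strict inequality reverses
   strictly. *)
have not_lt p q r t : first_crossing (f p) (f q) t -> f p 0 < f q 0 ->
    r != p -> r != q -> (f r t < f p t) = ~~ (f p t < f r t).
  move=> [[t01 e] _] pq rp rq; rewrite -leNgt lt_neqAle andb_idl // => _.
  apply/eqP => e'; apply: (@system_no_triple _ _ _ sys r p q t) => //.
  rewrite /= !inE negb_or rp rq /= andbT.
  by apply: contraTneq pq => ->; rewrite ltxx.
have [a [b [c [_ [ab bc _]]]]] := ex_left_sorted4 sys reg.1.
have xz : bx || bz.
  apply: contraT; rewrite negb_or => /andP[/negbTE bxF /negbTE bzF].
  have [t ft] := cross a b ab.
  have [Hx _ Hz] := orders a b c ab bc; rewrite bxF bzF in Hx Hz.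
  have ac := lt_trans ab bc; have neq i j : f i 0 < f j 0 -> j != i.
    by move=> ij; apply: contraTneq ij => ->; rewrite ltxx.
  have cat := not_lt _ _ _ _ ft ab (neq _ _ ac) (neq _ _ bc).
  rewrite (Hx t ft) in cat; have [[t01 eab] tmin] := ft.
  (* As [bx] is false, [c] is below the crossing of [a] and [b]; hence [b] and [c] have crossed
     before [t], and their first crossing [v] satisfies [v < t]. *)
  have cbt : f c t < f b t by rewrite -eab cat.
  have t0 : 0 <= t by move: t01; rewrite in_itv /= => /andP[].
  have pf := system_path sys.
  have [u Su /andP[_ ut]] := path_order_change (pf b) (pf c) i0 t01 t0 bc cbt.
  have [v [Sv vmin]] := cross b c bc.
  have vt := le_lt_trans (vmin u Su) ut.
  have v01 : v \in `[0, 1] by case: Sv.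
  have v0 : 0 <= v by move: v01; rewrite in_itv /= => /andP[].
  have : ~~ (f a v < f b v) by rewrite (Hz v).
  (* As [bz] is false, [a] is not below [b] at [v]: whether they meet at [v] or have already
     swapped, they cross before [t], against minimality. *)
  rewrite -leNgt le_eqVlt => /orP[/eqP e|bav].
    by have := tmin v (conj v01 (esym e)); rewrite leNgt vt.
  have [s /tmin ts /andP[_ sv]] := path_order_change (pf a) (pf b) i0 v01 v0 ab bav.
  by have := lt_trans (le_lt_trans ts sv) vt; rewrite ltxx.
have [n _ nmax] := arg_maxP (fun i => f i 0) (erefl : xpredT a).
have [m _ mmin] := arg_minP (fun i => f i 0) (erefl : xpredT a).
have upper_max : in_upper_envelope f n.
  by exists 0 => // j jn; apply: (left_lt) => //; apply: nmax.
have lower_min : in_lower_envelope f m.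
  by exists 0 => // j jm; apply: (left_lt); [rewrite eq_sym|apply: mmin].
(* [q] is the immediate successor of [p] on the left, so a third path is never the middle one of its
   triple with [p] and [q], and only [bx] and [bz] are consulted. *)
have succ p : p != n -> exists2 q, f p 0 < f q 0 &
    forall r, r != p -> r != q -> f r 0 < f p 0 \/ f q 0 < f r 0.
  move=> pn; have pn0 := left_lt _ _ pn (nmax p isT).
  have [q pq qmin] := arg_minP (P := fun q => f p 0 < f q 0) (fun i => f i 0) pn0.
  exists q => // r rp rq; have [rp0|pr0] := ltP (f r 0) (f p 0); [by left|right].
  apply: (left_lt); first by rewrite eq_sym.
  by apply: qmin; apply: (left_lt) => //; rewrite eq_sym.
have pred q : q != m -> exists2 p, f p 0 < f q 0 &
    forall r, r != p -> r != q -> f r 0 < f p 0 \/ f q 0 < f r 0.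
  rewrite eq_sym => mq; have mq0 := left_lt _ _ mq (mmin q isT).
  have [p pq pmax] := arg_maxP (P := fun p => f p 0 < f q 0) (fun i => f i 0) mq0.
  exists p => // r rp rq; have [qr0|rq0] := ltP (f q 0) (f r 0); [by right|left].
  by apply: (left_lt) => //; apply: pmax; apply: (left_lt).
have [[bzT bxF]|[[bxT bzF]|[bxT bzT]]] :
    (bz /\ ~~ bx) \/ (bx /\ ~~ bz) \/ (bx /\ bz).
  by case: (bx) (bz) xz => [] [] // _; [right; right|right; left|left].
- left=> p; have [->//|pn] := eqVneq p n.
  have [q pq near_pq] := succ p pn; have [t ft] := cross p q pq.
  apply: (upper_after_first_crossing sys pq ft) => r rp rq.
  have [rp0|qr0] := near_pq r rp rq.
    by have [_ _ Hz] := orders r p q rp0 pq; rewrite (Hz t ft).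
  by have [Hx _ _] := orders p q r pq qr0; rewrite (not_lt _ _ _ _ ft) // (Hx t ft).
- right=> q; have [->//|qm] := eqVneq q m.
  have [p pq near_pq] := pred q qm; have [t ft] := cross p q pq.
  apply: (lower_after_first_crossing sys pq ft) => r rp rq.
  have [rp0|qr0] := near_pq r rp rq.
    have [_ _ Hz] := orders r p q rp0 pq.
    by rewrite -[_ < _]negbK -(not_lt _ _ _ _ ft pq rp rq) (Hz t ft).
  by have [Hx _ _] := orders p q r pq qr0; rewrite (Hx t ft).
have [byT|byF] := boolP by_.
- right=> q; have [->//|qm] := eqVneq q m.
  have mq : f m 0 < f q 0 by apply: (left_lt); [rewrite eq_sym|apply: mmin].
  have [t ft] := cross m q mq.
  apply: (lower_after_first_crossing sys mq ft) => r rm rq.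
  have mr : f m 0 < f r 0 by apply: (left_lt); [rewrite eq_sym|apply: mmin].
  (* With [m] lowest on the left, [m] and [q] are the outer pair or the lower pair of the triple, so
     [by_] or [bx] puts [r] above their crossing. *)
  have [rq0|qr0|/(system_left sys) e] := ltgtP (f r 0) (f q 0).
  + by have [_ Hy _] := orders m r q mr rq0; rewrite (Hy t ft).
  + by have [Hx _ _] := orders m q r mq qr0; rewrite (Hx t ft).
  + by rewrite e eqxx in rq.
- left=> p; have [->//|pn] := eqVneq p n.
  have pn0 : f p 0 < f n 0 by apply: (left_lt) => //; apply: nmax.
  have [t ft] := cross p n pn0.
  apply: (upper_after_first_crossing sys pn0 ft) => r rp rn.
  have rn0 : f r 0 < f n 0 by apply: (left_lt) => //; apply: nmax.
  (* With [n] highest on the left, [p] and [n] are the upper pair or the outer pair, so [bz] true or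
     [by_] false puts [r] below their crossing. *)
  have [rp0|pr0|/(system_left sys) e] := ltgtP (f r 0) (f p 0).
  + by have [_ _ Hz] := orders r p n rp0 pn0; rewrite (Hz t ft).
  + by have [_ Hy _] := orders p r n pr0 rn0; rewrite (not_lt _ _ _ _ ft) // (Hy t ft).
  + by rewrite e eqxx in rp.
Qed.
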